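(* Assume $\diamondsuit(\mathrm{non}(\mathcal{M}))$. Then there is a Radon-Nikodým compact space $K$ of weight $\aleph_1$ and a continuous function from $K$ onto a compact Hausdorff space $K'$ such that $K'$ is not Radon-Nikodým.
   Context: Compact spaces are Hausdorff. A metric $d$ on the set $K$ (not assumed to be compatible with the topology of $K$) \emph{fragments} the topological space $K$ if for every $\varepsilon>0$ and every non-empty $C\subseteq K$ there is an open set $U\subseteq K$ such that $U\cap C\neq\emptyset$ and the $d$-diameter of $U\cap C$ is less than $\varepsilon$. The metric $d$ is \emph{lower semi-continuous} if it is lower semi-continuous as a function $K\times K\to\mathbb{R}$. A compact space $K$ is \emph{Radon-Nikodým} if there is a lower semi-continuous metric fragmenting $K$. The weight $w(K)$ is the smallest cardinality of a basis of the topology of $K$. The principle $\diamondsuit(\mathrm{non}(\mathcal{M}))$. Let $2^{<\omega}=\bigcup_{n\in\omega}2^n$ be the set of finite $0$-$1$ sequences, $2^{<\omega_1}=\bigcup_{\alpha<\omega_1}2^\alpha$, and let $X=(2^{<\omega})^{2^{<\omega}}\times\omega^{2^{<\omega}\times\omega}$, where $(2^{<\omega})^{2^{<\omega}}$ is the set of all functions $2^{<\omega}\to 2^{<\omega}$ and $\omega^{2^{<\omega}\times\omega}$ is the set of all functions $2^{<\omega}\times\omega\to\omega$, both with the product topology of discrete spaces ($X$ is a Polish space homeomorphic to $\omega^\omega$). Let $\mathcal{M}$ be the collection of all $F_\sigma$ meager subsets of $X$. A function $F:2^{<\omega_1}\to\mathcal{M}$ is \emph{Borel} if for each $\alpha<\omega_1$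 the restriction $F\restriction 2^\alpha$ is Borel, where $\mathcal{M}$ is represented by codes: fix an enumeration $(U_k)_{k\in\omega}$ of a countable base of $X$; the set $\mathcal{C}$ of all $c\in 2^{\omega\times\omega}$ such that $\bigcup\{U_k:c(n,k)=1\}$ is dense in $X$ for every $n$ is a Borel subset of $2^{\omega\times\omega}$, and $c\in\mathcal{C}$ codes $M_c=\bigcup_{n}\big(X\setminus\bigcup\{U_k:c(n,k)=1\}\big)\in\mathcal{M}$; $F\restriction 2^\alpha$ is Borel if there is a Borel map $f_\alpha:2^\alpha\to\mathcal{C}$ with $F(\sigma)=M_{f_\alpha(\sigma)}$ for all $\sigma\in 2^\alpha$ (with $2^\alpha$ carrying the product topology). Then $\diamondsuit(\mathrm{non}(\mathcal{M}))$ is the statement: for every Borel $F:2^{<\omega_1}\to\mathcal{M}$ there is $\Delta:\omega_1\to X$ such that for every $\gamma\in 2^{\omega_1}$ the set $\{\alpha\in\omega_1:\Delta(\alpha)\notin F(\gamma\restriction\alpha)\}$ is stationary in $\omega_1$. *)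

(* Defs.v *)
From HB Require Import structures.
From mathcomp Require Import all_boot all_order all_algebra.
From mathcomp Require Import all_classical all_reals all_analysis borel_hierarchy
  wochoice.

Set Implicit Arguments.
Unset Strict Implicit.
Unset Printing Implicit Defensive.

Import Order.TTheory GRing.Theory Num.Theory.
Import numFieldNormedType.Exports.

Local Open Scope classical_set_scope.
Local Open Scope card_scope.
Local Open Scope ring_scope.

Definition compact_hausdorff (K : topologicalType) : Prop :=
  compact [set: K] /\ hausdorff_space K.

Record is_metric (R : realType) (K : Type) (d : K -> K -> R) : Prop := IsMetric {
  metric_ge0 : forall x y, 0 <= d x y;
  metric_eq0 : forall x y, d x y = 0 <-> x = y;
  metric_symmetric : forall x y, d x y = d y x;
  metric_triangle : forall x y z, d x z <= d x y + d y z }.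

Definition diameter (R : realType) (K : Type) (d : K -> K -> R) (A : set K) :
  \bar R := ereal_sup [set (d p.1 p.2)%:E | p in A `*` A].

Definition fragments (R : realType) (K : topologicalType) (d : K -> K -> R) :
    Prop :=
  forall e : R, 0 < e -> forall C : set K, C !=set0 ->
  exists U : set K,
    [/\ open U, U `&` C !=set0 & (diameter d (U `&` C) < e%:E)%E].

(* The metric [d] is unrelated to the topology of [K], whence the use of a bare
   function instead of the library's [metricType]. *)
Definition radon_nikodym (R : realType) (K : topologicalType) : Prop :=
  compact_hausdorff K /\
  exists d : K -> K -> R,
    [/\ is_metric d,
        lower_semicontinuous (fun p : K * K => (d p.1 p.2)%:E) &
        fragments d].

Definition has_weight (K : topologicalType) (T : Type) (A : set T) : Prop :=
  (exists2 B : set (set K), basis B & B #= A) /\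
  (forall B : set (set K), basis B -> A #<= B).

(* Up to isomorphism, omega_1 is the only uncountable well-order whose proper
   initial segments are all countable; its cardinal is aleph_1. *)
Record is_omega1 (disp : Order.disp_t) (W : orderType disp) : Prop := IsOmega1 {
  omega1_well_ordered : forall A : set W, A !=set0 ->
    exists2 x, A x & forall y, A y -> (x <= y)%O;
  omega1_uncountable : ~ countable [set: W];
  omega1_segment_countable : forall a : W, countable [set b : W | (b < a)%O] }.

Lemma uncountable_set_nat : ~ countable [set: set nat].
Proof.
move=> /pfcard_geP; case.
  by move/eqP; apply/negP/set0P; exists set0.
move=> [f].
have fs : forall A : set nat, exists n, f n = A.
  by move=> A; have [n _ <-] := @surj _ _ _ _ f A I; exists n.
have [n fn] := fs [set n | ~ f n n].
have : f n n <-> ~ f n n by rewrite {1}fn.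
tauto.
Qed.

Lemma omega1_exists : exists disp (W : orderType disp), is_omega1 W.
Proof.
have [R woR] := well_ordering_principle (set nat : eqType).
have minR : forall A : set (set nat), A !=set0 ->
    exists2 x, A x & forall y, A y -> R x y.
  move=> A [a Aa]; have [|z [[zA lz] _]] := woR (fun x => x \in A).
    by exists a; exact: mem_set.
  exists z; first exact: set_mem zA.
  by move=> y Ay; apply: lz; exact: mem_set.
have Rtot x y : R x y || R y x.
  have [|z [->|->] Hz] := minR [set x; y]; first by exists x; left.
    by apply/orP; left; apply: Hz; right.
  by apply/orP; right; apply: Hz; left.
have Rrefl x : R x x by have := Rtot x x; rewrite orbb.
have Ranti : antisymmetric R.
  move=> x y /andP[xy yx]; have [|z [_ zu]] := woR (mem [:: x; y]).
    by exists x; rewrite !inE eqxx.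
  rewrite -(zu x); last first.
    by split=> [|t]; rewrite !inE ?eqxx // => /orP[]/eqP->.
  by apply: zu; split=> [|t]; rewrite !inE ?eqxx ?orbT // => /orP[]/eqP->.
have Rtr : transitive R.
  move=> y x z xy yz.
  have [|m mm Hm] := minR [set t | t = x \/ t = y \/ t = z].
    by exists x; left.
  case: mm => [E|[E|E]]; subst m.
  - by apply: Hm; right; right.
  - have yx : R y x by apply: Hm; left.
    by have -> : x = y by apply: Ranti; rewrite xy yx.
  - have zy : R z y by apply: Hm; right; left.
    by have -> : z = y by apply: Ranti; rewrite zy yz.
pose seg a := [set b | R b a /\ b <> a].
have [S Sunc Sseg] : exists2 S : set (set nat), ~ countable S &
    forall a, S a -> countable (S `&` seg a).
  have [[a Ha]|/forallNP H] := pselect (exists a, ~ countable (seg a)); last first.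
    exists setT; first exact: uncountable_set_nat.
    by move=> a _; rewrite setTI; exact: contrapT (H a).
  have [|m Hm mm] := minR [set a | ~ countable (seg a)]; first by exists a.
  exists (seg m) => // b [bm nbm]; apply: sub_countable (_ : countable (seg b)).
    by apply: subset_card_le; exact: subIsetr.
  apply: contrapT => /mm mb; apply: nbm; apply: Ranti; by rewrite bm mb.
pose T : choiceType := S.
pose le (x y : T) := R (sval x) (sval y).
have le_refl : reflexive le by move=> x; exact: Rrefl.
have le_anti : antisymmetric le by move=> x y /Ranti/val_inj.
have le_trans : transitive le by move=> y x z; exact: Rtr.
have le_total : total le by move=> x y; exact: Rtot.
pose ax1 := Order.Le_isPOrder.Build Order.default_display T le_refl le_anti le_trans.
pose P : porderType Order.default_display := HB.pack T ax1.
pose ax2 := Order.POrder_isTotal.Build _ P le_total.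
pose W : orderType Order.default_display := HB.pack P ax2.
have leE (x y : W) : (x <= y)%O = R (sval x) (sval y) by [].
exists Order.default_display, W; split.
- move=> A [a Aa].
  have [|_ [z Az <-] Hz] := minR ((fun x : W => sval x) @` A).
    by exists (sval a), a.
  by exists z => // y Ay; rewrite leE; apply: Hz; exists y.
- move=> cW; apply: Sunc.
  have -> : S = (fun x : W => sval x) @` [set: W].
    apply/seteqP; split => [x Sx|_ [[x Sx] _ <-]]; last exact: set_mem Sx.
    by exists (exist _ x (mem_set Sx)).
  exact: sub_countable (card_image_le _ _) cW.
- move=> a.
  have aS : S (sval a) by case: a => x Sx; exact: set_mem Sx.
  apply: sub_countable (Sseg _ aS).
  have -> : S `&` seg (sval a) = (fun x : W => sval x) @` [set b : W | (b < a)%O].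
    apply/seteqP; split => [x [Sx [xa nxa]]|_ [b /= + <-]].
      exists (exist _ x (mem_set Sx)) => //=; rewrite lt_neqAle leE /= xa andbT.
      by apply/eqP => E; apply: nxa; rewrite -E.
    rewrite lt_neqAle => /andP[/eqP nba ba]; split.
      by case: b {nba ba} => x Sx; exact: set_mem Sx.
    split => // E; apply: nba; exact: val_inj.
  apply: (proj2 ((card_eqPle _ _).1 _)); apply: inj_card_eq => x y _ _.
  exact: val_inj.
Qed.

Definition unbounded (disp : Order.disp_t) (W : orderType disp) (C : set W) :
    Prop :=
  forall a : W, exists2 c, C c & (a < c)%O.

(* The hypotheses on [a] say that it is a nonzero limit point of [C]. *)
Definition order_closed (disp : Order.disp_t) (W : orderType disp) (C : set W) :
    Prop :=
  forall a : W, (exists b : W, (b < a)%O) ->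
    (forall b : W, (b < a)%O -> exists2 c, C c & (b < c < a)%O) -> C a.

Definition stationary (disp : Order.disp_t) (W : orderType disp) (S : set W) :
    Prop :=
  forall C : set W, unbounded C -> order_closed C -> S `&` C !=set0.

Definition spaceX : topologicalType :=
  (prod_topology (fun _ : seq bool => discrete_topology (seq bool)) *
   prod_topology (fun _ : seq bool * nat => discrete_topology nat))%type.

Definition cylinder (I D : eqType) (s : seq (I * D)) : set (I -> D) :=
  [set f | all (fun p => f p.1 == p.2) s].

Lemma open_cylinder (I D : choiceType) (s : seq (I * D)) :
  @open (prod_topology (fun _ : I => discrete_topology D)) (cylinder s).
Proof.
elim: s => [|p s IHs].
  rewrite (_ : cylinder _ = setT); first exact: openT.
  by apply/seteqP.
rewrite (_ : cylinder _ = proj p.1 @^-1` [set p.2] `&` cylinder s).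
  apply: openI => //; apply: open_comp.
    by move=> x _; exact: (@proj_continuous I (fun=> discrete_topology D)).
  exact: discrete_open.
apply/seteqP; split => f /=; rewrite /cylinder /=.
  by move=> /andP[/eqP].
by case=> /eqP -> ->.
Qed.

Lemma nbhs_cylinder (I D : choiceType)
    (f : prod_topology (fun _ : I => discrete_topology D)) (A : set (I -> D)) :
  nbhs f A -> exists s : seq (I * D), cylinder s f /\ cylinder s `<=` A.
Proof.
pose F := filter_from [set s : seq (I * D) | cylinder s f] (@cylinder I D).
have FF : Filter F.
  apply: filter_from_filter; first by exists [::].
  move=> s t fs ft; exists (s ++ t); first by rewrite /cylinder /= all_cat fs.
  by move=> g; rewrite /cylinder /= all_cat => /andP.
suff /[apply] -[s fs sA] : F --> f by exists s.
apply/cvg_sup => i B [_ [[C oC <-] Cf CB]].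
exists [:: (i, f i)]; first by rewrite /cylinder /= eqxx.
by move=> g; rewrite /cylinder /= andbT => /eqP gi; apply: CB; rewrite /= gi.
Qed.

Lemma open_rect (S T : topologicalType) (A : set S) (B : set T) :
  open A -> open B -> open (A `*` B).
Proof.
move=> oA oB; rewrite openE => -[x y] [/= Ax By].
by exists (A, B) => //; split; exact: open_nbhs_nbhs.
Qed.

Lemma spaceX_base_exists : exists U : nat -> set spaceX, basis (range U).
Proof.
pose P := (seq (seq bool * seq bool) * seq (seq bool * nat * nat))%type.
pose V (p : P) : set spaceX := cylinder p.1 `*` cylinder p.2.
exists (fun k => V (odflt ([::], [::]) (unpickle k))); split.
  move=> _ [k _ <-]; set p := odflt _ _.
  apply: open_rect; first exact: (@open_cylinder (seq bool) (seq bool) p.1).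
  exact: (@open_cylinder (seq bool * nat)%type nat p.2).
move=> x A [[A1 A2] [/= /nbhs_cylinder[s [sx sA]] /nbhs_cylinder[t [tx tA]]] AA].
exists (V (s, t)).
  split; last by [].
  by exists (pickle (s, t)) => //; rewrite pickleK.
by move=> y [/sA ? /tA ?]; apply: AA.
Qed.

Definition nowhere_dense (T : topologicalType) (A : set T) : Prop :=
  (closure A)^° = set0.

Definition meager (T : topologicalType) (A : set T) : Prop :=
  exists2 N : nat -> set T,
    (forall n, nowhere_dense (N n)) & A = \bigcup_n N n.

Definition borel_map (T U : topologicalType) (f : T -> U) : Prop :=
  forall B : set U, <<s @open U >> B -> <<s @open T >> (f @^-1` B).

(* The Cantor space 2^a for a < omega_1, with a identified with the set of its
   predecessors. *)
Definition cantor_seg (disp : Order.disp_t) (W : orderType disp) (a : W) :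
    topologicalType :=
  prod_topology (fun _ : {b : W | (b < a)%O} => bool).

Definition restrict_seg (disp : Order.disp_t) (W : orderType disp)
    (g : W -> bool) (a : W) : cantor_seg a :=
  fun b => g (sval b).
Arguments restrict_seg {disp W} g a.

Definition code_space : topologicalType :=
  prod_topology (fun _ : nat * nat => bool).

(* [U] is an enumeration of a base of [spaceX]. The code [c] stands for the
   F_sigma meager set [coded_set U c], the union over [n] of the complements of
   the dense open sets [code_open U c n]. *)
Definition code_open (U : nat -> set spaceX) (c : code_space) (n : nat) :
    set spaceX :=
  \bigcup_(k in [set k | c (n, k) = true]) U k.

Definition is_code (U : nat -> set spaceX) (c : code_space) : Prop :=
  forall n, dense (code_open U c n).

Definition coded_set (U : nat -> set spaceX) (c : code_space) : set spaceX :=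
  \bigcup_n ~` (code_open U c n).

(* The codes form a Borel subset of [code_space], so a Borel map into it with
   values in the codes is the same as a Borel map into the set of codes. *)
Definition borel_family (disp : Order.disp_t) (W : orderType disp)
    (U : nat -> set spaceX) (F : forall a : W, cantor_seg a -> set spaceX) :
    Prop :=
  forall a : W, exists f : cantor_seg a -> code_space,
    [/\ forall s, is_code U (f s),
        borel_map f &
        forall s, F a s = coded_set U (f s)].

Definition diamond_nonM (disp : Order.disp_t) (W : orderType disp)
    (U : nat -> set spaceX) : Prop :=
  forall F : forall a : W, cantor_seg a -> set spaceX,
    (forall a s, Fsigma (F a s) /\ meager (F a s)) ->
    borel_family U F ->
    exists Delta : W -> spaceX, forall g : W -> bool,
      stationary [set a : W | ~ F a (restrict_seg g a) (Delta a)].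

(* Main.v *)
Require Import Defs.
From HB Require Import structures.
From mathcomp Require Import all_boot all_order all_algebra.
From mathcomp Require Import all_classical all_reals all_analysis borel_hierarchy.
From mathcomp Require Import lra.

(** The space [K] is built from the first uncountable ordinal [W] as follows.
For every cell [q = (i, t)], with [i] in [W] and [t] a finite 0-1 sequence, [K]
has a clopen copy of the Cantor space, and for every [a] in [W] there is a
further Cantor space [fiber a] in the remainder; all fibers share the point 0.
The fiber of [a] is approached only by cells that [a] has selected: if [a]
attaches the finite sequence [s] to [q] ([guess a q = Some s]), the coordinate
[trace a q] maps the cell to the two points [t000...] and [t111...] of the
fiber, taking the second value exactly on the cylinder of [s] followed by 1.
Two distinct [a], [b] have only finitely many cells in common.  The quotient
[K'] replaces every fiber by an interval, through binary expansions.

[K] is Radon-Nikodym.  Points of [K] are 0-1 functions on a set of coordinates,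
and the distance of two points is the largest weight of a coordinate on which
they differ, with weights [2 ^ - level].  Such a distance is always a lower
semi-continuous ultrametric ([wdist_metric], [wdist_lsc]); it fragments as soon
as, for each [k], the coordinates of level below [k] can be made simultaneously
constant on a relatively open part of any subset.  This holds because
[guess a (i, t)] has length at most [bound a (size t)], so that inside one cell
the coordinates of small level depend on few digits
([rn_set_fragments]).

[K'] is not.  A fragmenting metric [d] on [K'] yields, in each cell [q = (i, t)]
with [size t = n], a cylinder [ext q] of [d]-diameter at most [4 ^ - n].  If
some [a] has [guess a q = Some (ext q)] for infinitely many cells over each [t]
of length [n], then lower semi-continuity bounds by [4 ^ - n] the distance in
the fiber interval between the images of [t000...] and [t111...].  In the
interval these [2 ^ n] pieces are consecutive, because [t0111...] and
[t1000...] are glued, so the endpoints are at distance at most [2 ^ - n].  If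
there are infinitely many such [n] the endpoints coincide, which is absurd
([glued_not_radon_nikodym]).  In [K] itself nothing is glued and the pieces
cannot be chained.

Such an [a] comes from the diamond principle.  Fix distinct reals [x a].  The
function [ext] is coded as a 0-1 function on [W], of which [a] sees the part
below [a].  A generic guess [y a] predicts both the bounds on lengths and the
cylinders; a cell [(i, t)] selected by [a] is found at the column [k] where
[x i] and [x a] first differ, which makes the selections of distinct [a], [b]
almost disjoint.  For a guess to be possible at [a], there must be, for each
[n], some [N] such that [x a] is a limit of reals [x i] whose cylinders at rank
[n] have length at most [N] and are visible from [a].  A pigeonhole argument
shows that all but countably many [a] have this property ([tame_often]). *)

Set Implicit Arguments.
Unset Strict Implicit.
Unset Printing Implicit Defensive.

Import Order.TTheory GRing.Theory Num.Theory.
Import numFieldNormedType.Exports.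

Local Open Scope classical_set_scope.
Local Open Scope card_scope.
Local Open Scope ring_scope.

(** * The first uncountable ordinal *)

Lemma countable_setU T (A B : set T) :
  countable A -> countable B -> countable (A `|` B).
Proof.
move=> cA cB; rewrite -bigcup2E; apply: bigcup_countable => // -[|[|n]] _ //=.
Qed.

Lemma omega1_wf disp (W : orderType disp) : is_omega1 W ->
  well_founded (fun a b : W => (a < b)%O).
Proof.
move=> oW a; apply: contrapT => na.
have [x nx xmin] := omega1_well_ordered oW (ex_intro (fun a => ~ Acc _ a) a na).
apply: nx; constructor => y yx; apply: contrapT => /xmin.
by rewrite leNgt yx.
Qed.

(** Every initial segment of the first uncountable ordinal is countable, so a
requirement that can be met against any countable set of earlier choices can be
met along the whole ordinal. *)
Lemma omega1_rec disp (W : orderType disp) (T : Type)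
    (Q : set T -> T -> Prop) : is_omega1 W ->
  (forall A, countable A -> exists z, Q A z) ->
  exists h : W -> T, forall a, Q (h @` [set b | (b < a)%O]) (h a).
Proof.
move=> oW exQ; have [z0 _] := exQ set0 (countable0 _).
pose A (a : W) (r : forall b, (b < a)%O -> T) : set T :=
  [set z | exists b (ba : (b < a)%O), z = r b ba].
pose F a r := if pselect (exists z, Q (@A a r) z) is left e then sval (cid e)
  else z0.
pose h := Fix (omega1_wf oW) (fun _ => T) F.
have hE a : h a = F a (fun b _ => h b).
  rewrite /h Fix_eq // => b f g fg; congr (F b _).
  by apply: functional_extensionality_dep => c;
     apply: functional_extensionality_dep => ?.
exists h => a; rewrite hE /F.
have AE : h @` [set b | (b < a)%O] = A a (fun b _ => h b).
  apply/seteqP; split => [_ [b ba <-]|_ [b [ba ->]]]; first by exists b, ba.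
  by exists b.
rewrite AE; case: pselect => [e|[]]; first exact: svalP (cid e).
apply: exQ; rewrite -AE.
exact: sub_countable (card_image_le _ _) (omega1_segment_countable oW a).
Qed.

Lemma omega1_countable_bounded disp (W : orderType disp) (A : set W) :
  is_omega1 W -> countable A -> exists b, forall a, A a -> (a < b)%O.
Proof.
move=> oW cA; apply: contrapT => /forallNP nb; apply: (omega1_uncountable oW).
have -> : [set: W] = \bigcup_(a in A) ([set b | (b < a)%O] `|` [set a]).
  apply/seteqP; split => // b _.
  have /existsNP[a /not_implyP[Aa /negP]] := nb b.
  rewrite -leNgt le_eqVlt => /orP[/eqP ->|ba]; first by exists a => //; right.
  by exists a => //; left.
apply: bigcup_countable => // a _.
by apply: countable_setU => //; exact: omega1_segment_countable.
Qed.

(** Each value avoids the countable set of the earlier ones. *)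
Lemma omega1_embeds disp (W : orderType disp) (T : Type) : is_omega1 W ->
  ~ countable [set: T] -> exists x : W -> T, injective x.
Proof.
move=> oW unT.
have [A cA|x xP] := @omega1_rec _ W T (fun A z => ~ A z) oW.
  apply: contrapT => /forallNP nA; apply: unT.
  suff -> : [set: T] = A by [].
  by apply/seteqP; split => // z _; apply: contrapT => /nA.
exists x => a b xab; apply/eqP; case: ltgtP => // ab.
- by case: (xP b); exists a.
- by case: (xP a); exists b.
Qed.

Lemma cantor_uncountable : ~ countable [set: nat -> bool].
Proof.
move=> cT; apply: uncountable_set_nat.
rewrite (_ : [set: set nat] = (fun f n => f n = true) @` [set: nat -> bool]).
  exact: sub_countable (card_image_le _ _) cT.
apply/seteqP; split => // A _; exists (fun n => `[< A n >]) => //.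
by apply/funext => n; apply/propext; split => [/asboolP|An]; last exact/asboolP.
Qed.

(** Choose recursively pairwise disjoint infinite sequences: at each stage the
ranges used so far are countable, hence bounded, and the iterated successors of
a bound give a new one. *)
Lemma omega1_prod_nat disp (W : orderType disp) : is_omega1 W ->
  exists p : W * nat -> W, injective p.
Proof.
move=> oW.
pose Q (A : set (nat -> W)) (z : nat -> W) :=
  injective z /\ forall f, A f -> forall m n, z m <> f n.
have [A cA|h hP] := @omega1_rec _ W (nat -> W) Q oW.
  have [b bP] : exists b : W, forall a,
      (\bigcup_(f in A) range f) a -> (a < b)%O.
    apply: (omega1_countable_bounded oW); apply: bigcup_countable => // f _.
    exact: sub_countable (card_image_le _ _) (countableP _).
  have /choice[s sP] : forall a : W, exists c, (a < c)%O.
    move=> a; have [c cP] := omega1_countable_bounded oW (countable1 a).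
    by exists c; exact: cP.
  pose e n := iter n s b.
  have elt m n : (m < n)%N -> (e m < e n)%O.
    apply: (@homo_ltn _ e (fun a b => (a < b)%O)) => [y x z|k]; last exact: sP.
    exact: lt_trans.
  have be n : (b <= e n)%O by case: n => // n; exact/ltW/(elt 0%N).
  exists e; split=> [m n E|f Af m n E].
    by case: (ltngtP m n) => // /elt; rewrite E ltxx.
  have /bP : (\bigcup_(f in A) range f) (f n) by exists f => //; exists n.
  by rewrite -E ltNge be.
exists (fun q => h q.1 q.2) => -[a m] [b n] /= E.
case: (ltgtP a b) E => [ab|ba|->] E.
- by case: (hP b) => _ /(_ (h a)) H; case: (H _ n m) => //; exists a.
- by case: (hP a) => _ /(_ (h b)) H; case: (H _ m n) => //; exists b.
- by congr (_, _); case: (hP b) => + _; exact.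
Qed.

(** * Borel predicates and the guessing principle *)

Section BorelSets.
Variable T : topologicalType.

Definition borel (A : set T) : Prop := <<s @open T >> A.

Lemma borel_open A : open A -> borel A.
Proof. exact: (@sub_gen_smallest _ (sigma_algebra [set: T]) open). Qed.

Lemma borel_ext (P Q : T -> Prop) : borel [set x | P x] ->
  (forall x, P x <-> Q x) -> borel [set x | Q x].
Proof. by move=> bP PQ; rewrite -(_ : P = Q) //; apply/funext => x; exact/propext. Qed.

Lemma borel_not (P : T -> Prop) : borel [set x | P x] -> borel [set x | ~ P x].
Proof.
move=> bP; have [_ /(_ _ bP) + _] := @smallest_sigma_algebra T setT open.
by rewrite setTD.
Qed.

Lemma borel_exists (I : countType) (P : I -> T -> Prop) :
  (forall i, borel [set x | P i x]) -> borel [set x | exists i, P i x].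
Proof.
move=> bP; have [b0 _ bU] := @smallest_sigma_algebra T setT open.
rewrite (_ : [set _ | _] = \bigcup_n
    (if choice.unpickle n is Some i then [set x | P i x] else set0)).
  by apply: bU => n; case: choice.unpickle => [i|//]; exact: bP.
apply/seteqP; split => x.
  by move=> [i Pix]; exists (choice.pickle i) => //; rewrite choice.pickleK.
by move=> [n _]; case: choice.unpickle => // i Pix; exists i.
Qed.

Opaque borel.

Lemma borel_forall (I : countType) (P : I -> T -> Prop) :
  (forall i, borel [set x | P i x]) -> borel [set x | forall i, P i x].
Proof.
move=> bP; have : borel [set x | ~ exists i, ~ P i x].
  by apply: borel_not; apply: borel_exists => i; exact: borel_not.
move=> /borel_ext; apply => x; split => [/forallNP H i|H [i]]; last exact.
by apply: contrapT; exact: H.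
Qed.

Lemma borel_const (P : Prop) : borel [set _ | P].
Proof.
apply: borel_open; have [p|np] := pselect P.
  by rewrite (_ : [set _ | _] = setT); [exact: openT|apply/seteqP; split].
by rewrite (_ : [set _ | _] = set0); [exact: open0|apply/seteqP; split].
Qed.

Lemma borel_and (P Q : T -> Prop) :
  borel [set x | P x] -> borel [set x | Q x] -> borel [set x | P x /\ Q x].
Proof.
move=> bP bQ; have : borel [set x | forall b : bool, (if b then P else Q) x].
  by apply: borel_forall => b; case: b.
move=> /borel_ext; apply => x; split.
  by move=> H; split; [exact: (H true)|exact: (H false)].
by move=> [Px Qx] [].
Qed.

Lemma borel_or (P Q : T -> Prop) :
  borel [set x | P x] -> borel [set x | Q x] -> borel [set x | P x \/ Q x].
Proof.
move=> bP bQ; have : borel [set x | exists b : bool, (if b then P else Q) x].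
  by apply: borel_exists => b; case: b.
move=> /borel_ext; apply => x; split.
  by move=> [[]]; [left|right].
by move=> [Px|Qx]; [exists true|exists false].
Qed.

Lemma borel_imp (P Q : T -> Prop) :
  borel [set x | P x] -> borel [set x | Q x] -> borel [set x | P x -> Q x].
Proof.
move=> bP bQ; have : borel [set x | ~ P x \/ Q x].
  by apply: borel_or => //; exact: borel_not.
move=> /borel_ext; apply => x; split.
  by case.
by move=> PQ; have [/PQ|] := pselect (P x); [right|left].
Qed.

End BorelSets.

Transparent borel.

Lemma nbhs_bool_cylinder (I : choiceType)
    (f : prod_topology (fun _ : I => bool)) (A : set (I -> bool)) :
  nbhs f A -> exists s : seq (I * bool), cylinder s f /\ cylinder s `<=` A.
Proof. exact: nbhs_cylinder. Qed.

(** The code space has a countable base of finite intersections of coordinate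
conditions, so measurability can be tested on coordinates. *)
Lemma borel_map_code (T : topologicalType) (f : T -> code_space) :
  (forall q, borel [set x | f x q = true]) -> borel_map f.
Proof.
move=> bf B; have bq q b : borel [set x | f x q == b].
  case: b; first by have := bf q; move=> /borel_ext; apply => x; split => /eqP.
  have := borel_not (bf q); move=> /borel_ext; apply => x.
  by case: (f x q); split.
have bcyl (s : seq ((nat * nat) * bool)) :
    borel [set x | (cylinder s : set (nat * nat -> bool)) (f x)].
  elim: s => [|p s IHs]; first exact: (@borel_const _ (is_true true)).
  have := borel_and (bq p.1 p.2) IHs; move=> /borel_ext; apply => x.
  by rewrite /cylinder /=; split => /andP.
move: B; apply: smallest_sub.
  split.
  - by rewrite preimage_set0; exact: borel_open open0.
  - by move=> A; rewrite setTD preimage_setC; exact: borel_not.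
  - move=> A bA; rewrite preimage_bigcup.
    by have [_ _ +] := @smallest_sigma_algebra T setT open; exact.
move=> O oO; have : borel [set x | exists s : seq ((nat * nat) * bool),
    cylinder s `<=` O /\ (cylinder s : set (nat * nat -> bool)) (f x)].
  by apply: borel_exists => s; apply: borel_and; [exact: borel_const|exact: bcyl].
move=> /borel_ext; apply => x; split.
  by move=> [s [sO]]; exact: sO.
move=> Ofx; have [|s [sfx sO]] := @nbhs_bool_cylinder (nat * nat)%type (f x) O.
  exact: open_nbhs_nbhs.
by exists s.
Qed.

Lemma coded_set_Fsigma (U : nat -> set spaceX) (baseU : basis (range U)) c :
  is_code U c -> Fsigma (coded_set U c) /\ meager (coded_set U c).
Proof.
move=> cc; have oc n : open (code_open U c n).
  by apply: bigcup_open => k _; apply: baseU.1; exists k.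
split; exists (fun n => ~` code_open U c n) => //.
  by move=> n; exact: open_closedC.
move=> n; rewrite /nowhere_dense.
have /closure_id <- : closed (~` code_open U c n) by exact: open_closedC.
apply/seteqP; split => // z zi.
have [y [yi yc]] := cc n _ (ex_intro _ z zi) (open_interior _).
exact: (interior_subset yi).
Qed.

(** The form in which the diamond principle is used.  A countable family of
open subsets of the space of functions is described, for each [s], by the basic
cylinders that it contains; when every member of the family is dense and the
description is Borel in [s], the complement of the intersection is a legitimate
value for the family [F] of the principle, and [y] is a guess that is generic
against it. *)
Lemma diamond_dense disp (W : orderType disp) (U : nat -> set spaceX) 
  (M : countType)
  (P : forall a : W, M -> seq ((seq bool * nat) * nat) -> set (cantor_seg a)) :
  basis (range U) -> diamond_nonM W U ->
  (forall a m w, borel (P a m w)) ->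
  (forall a m s w0 z0, cylinder w0 z0 ->
    exists w (z : seq bool * nat -> nat),
      [/\ @P a m w s, cylinder w0 z & cylinder w z]) ->
  exists y : W -> seq bool * nat -> nat, forall g : W -> bool,
    stationary [set a | forall m, exists w,
      @P a m w (restrict_seg g a) /\ cylinder w (y a)].
Proof.
move=> baseU dia bP dP.
(* Natural numbers that code no index contribute the whole space. *)
pose P' (a : W) n w : set (cantor_seg a) :=
  if choice.unpickle n is Some m then @P a m w else setT.
(* Containment of [U j] in the whole open set would not be visibly Borel in [s];
   containment in a single described cylinder is. *)
pose f (a : W) (s : cantor_seg a) : code_space := fun q =>
  `[< exists w, @P' a q.1 w s /\ U q.2 `<=` setT `*` cylinder w >].
have fE a s n : code_open U (@f a s) n =
    [set p | exists w, @P' a n w s /\ cylinder w p.2].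
  apply/seteqP; split => [p [j /asboolP[w [Pw Uw]] Ujp]|p [w [Pw wp]]].
    by exists w; split => //; have [] := Uw _ Ujp.
  have ow : open (setT `*` cylinder w : set spaceX).
    by apply: open_rect; [exact: openT|
      exact: (@open_cylinder (seq bool * nat)%type nat w)].
  have [|_ [[j _ <-] Up] Uw] := baseU.2 p (setT `*` cylinder w).
    exact: open_nbhs_nbhs.
  by exists j => //; apply/asboolP; exists w.
have fcode a s : is_code U (@f a s).
  move=> n O [p Op] oO; rewrite fE.
  have : nbhs p O by exact: open_nbhs_nbhs.
  move=> [[A1 A2] /= [A1p A2p] AO].
  have [w0 [w0p w0A]] := @nbhs_cylinder (seq bool * nat)%type nat p.2 A2 A2p.
  have [w [z [Pw w0z wz]]] : exists w (z : seq bool * nat -> nat),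
      [/\ @P' a n w s, cylinder w0 z & cylinder w z].
    rewrite /P'; case: choice.unpickle => [m|]; first exact: dP w0p.
    by exists [::], p.2.
  exists (p.1, z); split; last by exists w.
  by apply: AO; split => /=; [exact: nbhs_singleton A1p|exact: w0A].
have [|a|D DP] := dia (fun a s => coded_set U (@f a s)).
- by move=> a s; exact: coded_set_Fsigma.
- exists (@f a); split => //; apply: borel_map_code => q.
  have : borel [set s | exists w, @P' a q.1 w s /\ U q.2 `<=` setT `*` cylinder w].
    apply: borel_exists => w; apply: borel_and; last exact: borel_const.
    rewrite /P'; case: choice.unpickle => [m|]; first exact: bP.
    exact: (@borel_const _ True).
  move=> /borel_ext; apply => s; split => [H|/asboolP]; last by [].
  exact/asboolP.
exists (fun a => (D a).2) => g C uC cC.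
have [a [Da Ca]] := DP g C uC cC; exists a; split => // m.
have : code_open U (f a (restrict_seg g a)) (choice.pickle m) (D a).
  by apply: contrapT => nD; apply: Da; exists (choice.pickle m).
by rewrite fE /P' choice.pickleK.
Qed.

Lemma stationary_uncountable disp (W : orderType disp) (S : set W) :
  is_omega1 W -> stationary S -> ~ countable S.
Proof.
move=> oW sS cS; have [b bS] := omega1_countable_bounded oW cS.
have [a|a [b0 b0a] H|c [Sc] /=] := sS [set c | (b <= c)%O].
- have [c cP] := omega1_countable_bounded oW
    (countable_setU (countable1 a) (countable1 b)).
  by exists c; [apply/ltW/cP; right|apply: cP; left].
- have [c bc /andP[_ ca]] := H _ b0a; exact: le_trans bc (ltW ca).
- by rewrite leNgt bS.
Qed.

(** * Cubes and weighted ultrametrics *)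

Definition cube (I : choiceType) : topologicalType :=
  prod_topology (fun _ : I => discrete_topology bool).

Section Cube.
Variable I : choiceType.

Lemma nbhs_cube (f : cube I) (s : seq I) : nbhs f [set g : cube I | forall c, c \in s -> g c = f c].
Proof.
apply: filterS (_ : nbhs f (cylinder [seq (c, f c) | c <- s])).
  by move=> g /allP H c cs; apply/eqP/(H (c, f c)); exact: map_f.
apply: open_nbhs_nbhs; split; first exact: (@open_cylinder I bool).
by apply/allP => _ /mapP[c _ ->] /=.
Qed.

Lemma nbhs_cubeE (f : cube I) (A : set (cube I)) : nbhs f A ->
  exists s : seq I, [set g : cube I | forall c, c \in s -> g c = f c] `<=` A.
Proof.
move=> /nbhs_cylinder[s [sf sA]]; exists (map fst s) => g gf; apply: sA.
apply/allP => p ps; rewrite gf; last exact: map_f.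
exact: (allP sf).
Qed.

Lemma cube_closed (A : set (cube I)) :
  (forall f, (forall s : seq I, exists2 g, A g & forall c, c \in s -> g c = f c) -> A f) ->
  closed A.
Proof.
move=> H f clf; apply: H => s; have [g [Ag gf]] := clf _ (nbhs_cube f s).
by exists g.
Qed.

Lemma cube_compact : compact [set: cube I].
Proof.
have := @tychonoff I (fun=> discrete_topology bool) (fun=> setT).
rewrite (_ : [set _ | _] = setT); last by apply/seteqP.
by apply => _; apply: finite_compact; exact: finite_finset.
Qed.

Lemma cube_hausdorff : hausdorff_space (cube I).
Proof.
apply: hausdorff_product => _; exact: discrete_hausdorff.
Qed.

End Cube.

Lemma hausdorff_set_type (T : topologicalType) (A : set T) :
  hausdorff_space T -> hausdorff_space A.
Proof.
move=> hT x y xy; apply: val_inj; apply: hT => B C nB nC.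
have [||z [Bz Cz]] := xy (set_val @^-1` B) (set_val @^-1` C).
- exact: initial_continuous.
- exact: initial_continuous.
- by exists (set_val z).
Qed.

Lemma compact_set_type (T : topologicalType) (A : set T) :
  compact A -> compact [set: A].
Proof.
move=> cA F PF _; pose G : set_system T := set_val @ F.
have [|t [At Gt]] := cA G _.
  by apply: (@filterS _ F) filterT => x _; exact: set_valP.
exists (exist _ t (mem_set At)); split => // B C FB nC.
move: nC => [_ [[D oD <-] Dt DC]].
have GB : G (set_val @` B).
  have : F (set_val @^-1` (set_val @` B)) by apply: filterS FB => b Bb; exists b.
  by [].
have [_ [[b Bb <-] Db]] := Gt _ _ GB (open_nbhs_nbhs (conj oD Dt)).
by exists b; split => //; exact: DC.
Qed.

Lemma nbhs_coord (I : choiceType) (A : set (cube I)) (x : A) (c : I) :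
  nbhs x [set y : A | set_val y c = set_val x c].
Proof.
apply: (@initial_continuous A (cube I) set_val x [set g | g c = set_val x c]).
apply: filterS (nbhs_cube _ [:: c]) => g /(_ c); apply; exact: mem_head.
Qed.

Section WeightedDistance.
Variables (R : realType) (I : choiceType) (wt : I -> nat).

Let h n : R := 2^-1 ^+ n.

Let h_gt0 n : 0 < h n. Proof. by rewrite /h exprn_gt0. Qed.

Let h_le1 n : h n <= 1.
Proof. by rewrite /h exprn_ile1 ?invr_ge0 // invf_le1 ?ler1n. Qed.

Let V (p q : I -> bool) : set R :=
  [set r | r = 0 \/ exists c, p c <> q c /\ r = h (wt c)].

Definition wdist (p q : I -> bool) : R := sup (V p q).

Let V_sup p q : has_sup (V p q).
Proof.
split; first by exists 0; left.
by exists 1 => _ [->|[c [_ ->]]].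
Qed.

Lemma wdist_ge0 p q : 0 <= wdist p q.
Proof. by apply: ub_le_sup; [exact: (V_sup p q).2|left]. Qed.

Lemma wdist_ge p q c : p c <> q c -> h (wt c) <= wdist p q.
Proof. by move=> pq; apply: ub_le_sup; [exact: (V_sup p q).2|right; exists c]. Qed.

Lemma wdist_le p q r : 0 <= r -> (forall c, p c <> q c -> h (wt c) <= r) ->
  wdist p q <= r.
Proof.
move=> r0 H; apply: ge_sup; first exact: (V_sup p q).1.
by move=> _ [->|[c [pq ->]]] //; exact: H.
Qed.

Lemma wdist_metric : is_metric wdist.
Proof.
split.
- exact: wdist_ge0.
- move=> p q; split => [pq0|->].
    apply/funext => c; apply: contrapT => /wdist_ge.
    by rewrite pq0 leNgt h_gt0.
  by apply/eqP; rewrite eq_le wdist_ge0 andbT; apply: wdist_le.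
- move=> p q; congr sup; apply/seteqP.
  by split => r [->|[c [pq ->]]]; [left|right; exists c; split => // /esym|
     left|right; exists c; split => // /esym].
- move=> p q r; apply: wdist_le => [|c pr].
    by apply: addr_ge0; exact: wdist_ge0.
  have [pq|pq] := pselect (p c = q c).
    by rewrite (le_trans (@wdist_ge q r c _)) ?lerDr ?wdist_ge0 // -pq.
  by rewrite (le_trans (@wdist_ge p q c pq)) // lerDl wdist_ge0.
Qed.

Lemma wdist_lt p q r : 0 <= r -> r < wdist p q ->
  exists2 c, p c <> q c & r < h (wt c).
Proof.
move=> r0 rpq; apply: contrapT => H; move: rpq; rewrite ltNge => /negP; apply.
by apply: wdist_le => // c pq; rewrite leNgt; apply/negP => rc; apply: H; exists c.
Qed.

(** The set where the distance exceeds [a >= 0] is the union, over the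
coordinates of weight above [a], of the open conditions that the two points
differ there. *)
Lemma wdist_lsc (A : set (cube I)) :
  lower_semicontinuous
    (fun p : A * A => (wdist (set_val p.1) (set_val p.2))%:E).
Proof.
move=> [p q] a /=; rewrite lte_fin => apq.
have [a0|a0] := ltP a 0.
  exists setT; first exact: filterT.
  by move=> [x y] _ /=; rewrite lte_fin (lt_le_trans a0) ?wdist_ge0.
have [c pqc ac] := wdist_lt a0 apq.
exists ([set x : A | set_val x c = set_val p c] `*`
        [set x : A | set_val x c = set_val q c]).
  exists ([set x : A | set_val x c = set_val p c],
        [set x : A | set_val x c = set_val q c]) => //=.
  by split; exact: nbhs_coord.
move=> [x y] /= [xp yq]; rewrite lte_fin (lt_le_trans ac) //.
by apply: wdist_ge; rewrite xp yq.
Qed.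

Lemma small_pow (e : R) : 0 < e -> exists n, h n < e.
Proof.
move=> e0; have : h @ \oo --> (0 : R).
  by apply: cvg_expr; rewrite ger0_norm ?invr_ge0 // invf_lt1 ?ltr1n.
move=> /cvgr0_norm_lt /(_ _ e0)[n _ /(_ n (leqnn n))] /=.
by rewrite ger0_norm ?(ltW (h_gt0 n)) //; exists n.
Qed.

(** Fragmentation is reduced to a statement without topology: some finite set
of coordinates of a point of [C] decides all coordinates of small level. *)
Lemma wdist_fragments (A : set (cube I)) :
  (forall (C : set (cube I)) k, C `<=` A -> C !=set0 -> exists p0 (s : seq I),
    C p0 /\ forall p q, C p -> C q -> (forall c, c \in s -> p c = p0 c) ->
      (forall c, c \in s -> q c = p0 c) ->
      forall c, (wt c < k)%N -> p c = q c) ->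
  fragments (fun p q : A => wdist (set_val p) (set_val q)).
Proof.
move=> H e e0 C [c0 Cc0]; have [k ke] := small_pow e0.
have [||p0 [s [[x Cx xp0] sP]]] := H (set_val @` C) k.
- by move=> _ [x _ <-]; exact: set_valP.
- by exists (set_val c0), c0.
have := nbhs_cube p0 s; rewrite nbhsE; move=> [D [oD Dp0] Ds].
exists (set_val @^-1` D); split.
- by exists D.
- by exists x; split => //; rewrite /= xp0.
apply: (@le_lt_trans _ _ (h k)%:E); last by rewrite lte_fin.
apply: ge_ereal_sup => _ [[p q] [[/= Dp Cp] [/= Dq Cq]] <-].
rewrite lee_fin; apply: wdist_le; first exact: ltW.
move=> c pq; have : ~ (wt c < k)%N.
  move=> ck; apply: pq.
  by apply: sP => //; [exists p|exists q|exact: Ds|exact: Ds].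
move=> /negP; rewrite -leqNgt => kc.
by rewrite /h ler_wiXn2l ?invr_ge0 // invf_le1 ?ler1n.
Qed.

End WeightedDistance.

(** * The Radon-Nikodym compactum *)

Section Points.
Variable W : choiceType.

(** The index [(i, t)] of a clopen Cantor set: [t] names the piece of a fiber
that the cell may approach. *)
Definition cell : choiceType := (W * seq bool)%type.
(** [inl (q, 0)] tells whether a point lies in the cell [q] and [inl (q, k.+1)]
is its [k]-th digit there; [inr (a, n)] is the [n]-th digit in the fiber of
[a]. *)
Definition coord : choiceType := ((cell * nat) + (W * nat))%type.

Variables (guess : W -> cell -> option (seq bool)) (bound : W -> nat -> nat).

Definition switch (s : seq bool) (y : nat -> bool) : bool :=
  (mkseq y (size s) == s) && y (size s).

(** Inside a cell selected by [a], only the two ends of the piece [q.2] of the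
fiber are attained, and which one is decided by the digit following [s].  All
that fragmentation needs is that this digit comes early. *)
Definition trace (a : W) (q : cell) (y : nat -> bool) (n : nat) : bool :=
  if guess a q is Some s then
    if (n < size q.2)%N then nth false q.2 n else switch s y
  else false.

Definition cell_point (q : cell) (y : nat -> bool) (c : coord) : bool :=
  match c with
  | inl (q', k) => (q' == q) && (if k is k'.+1 then y k' else true)
  | inr (a, n) => trace a q y n
  end.

Definition fiber_point (a : W) (z : nat -> bool) (c : coord) : bool :=
  match c with
  | inl _ => false
  | inr (b, n) => (b == a) && z n
  end.

Definition rn_set : set (cube coord) :=
  [set p | (exists q y, p = cell_point q y) \/ (exists a z, p = fiber_point a z)].

(** Tends to infinity with [n] in each fiber, and is larger than every bound
[bound a k] with [k <= n]: a coordinate [inr (a, n)] of small level thus depends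
on few digits within any cell selected by [a]. *)
Definition level (c : coord) : nat :=
  match c with
  | inl (_, k) => k
  | inr (a, n) => \sum_(k < n.+1) (bound a k).+1
  end.

Hypothesis guess_bound : forall a q s,
  guess a q = Some s -> (size s <= bound a (size q.2))%N.
Hypothesis guess_ad : forall a b, a <> b ->
  exists L : seq cell, forall q, guess a q -> guess b q -> q \in L.

Lemma switch_ext s y y' : (forall k, (k <= size s)%N -> y k = y' k) ->
  switch s y = switch s y'.
Proof.
move=> yy'; rewrite /switch yy' //; congr ((_ == _) && _).
apply: (@eq_from_nth _ false) => [|k]; rewrite !size_mkseq // => ks.
by rewrite !nth_mkseq // yy' // ltnW.
Qed.

Lemma cell_point_ext q c : exists m, forall y y',
  (forall k, (k < m)%N -> y k = y' k) -> cell_point q y c = cell_point q y' c.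
Proof.
case: c => [[q' k]|[a n]].
  by exists k.+1 => y y' yy' /=; case: k yy' => // k ->.
case E: (guess a q) => [s|]; last by exists 0%N => y y' _ /=; rewrite /trace E.
exists (size s).+1 => y y' yy' /=; rewrite /trace E; case: ifP => // _.
exact: switch_ext.
Qed.

(** A limit of points of the set either keeps a cell indicator equal to 1, and
then lies in that cell, or has all cell coordinates equal to 0.  In the second
case two digits 1 in the fibers of distinct [a], [b] would come from one of the
finitely many cells selected by both, whose indicator would be kept. *)
Lemma closed_rn_set (w0 : W) : closed rn_set.
Proof.
apply: cube_closed => f clf.
have [[q fq]|nq] := pselect (exists q, f (inl (q, 0%N)) = true).
  left; exists q, (fun k => f (inl (q, k.+1))); apply/funext => c.
  have [m mP] := cell_point_ext q c.
  have [g Ag gf] := clf (c :: inl (q, 0%N) ::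
    [seq inl (q, k.+1) | k <- iota 0 m]).
  have gq : g (inl (q, 0%N)) = true by rewrite gf // !inE eqxx orbT.
  rewrite -gf ?mem_head //; case: Ag => [[q' [y gE]]|[a [z gE]]]; last first.
    by rewrite gE in gq.
  move: gq; rewrite gE /= andbT => /eqP qq'; subst q'.
  apply: mP => k km; have := gf (inl (q, k.+1)); rewrite gE /= eqxx /= => ->//.
  rewrite !inE; apply/orP; right; apply/orP; right; apply/mapP; exists k => //.
  by rewrite mem_iota.
have f0 q k : f (inl (q, k)) = false.
  apply/negbTE/negP => fqk.
  have [g Ag gf] := clf [:: inl (q, k); inl (q, 0%N)].
  apply: nq; exists q; rewrite -gf ?inE ?eqxx ?orbT //.
  move: fqk; rewrite -gf ?inE ?eqxx //.
  by case: Ag => [[q' [y ->]]|[a [z ->]]] //= /andP[->].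
right; have [[a [n fan]]|nf] := pselect (exists a n, f (inr (a, n)) = true).
  exists a, (fun k => f (inr (a, k))); apply/funext => -[[q k]|[b k]] /=.
    exact: f0.
  have [->|/eqP ba] := eqVneq b a; first by [].
  apply/negbTE/negP => fbk.
  have [L LP] := guess_ad ba.
  have [g Ag gf] := clf (inr (a, n) :: inr (b, k) ::
    [seq inl (q, 0%N) | q <- L]).
  move: fan fbk; rewrite -!gf ?inE ?eqxx ?orbT //.
  case: Ag => [[q [y gE]]|[a' [z gE]]].
    rewrite gE /= /trace; case Ea: (guess a q) => // _.
    case Eb: (guess b q) => // _.
    have qL : q \in L by apply: LP; rewrite ?Ea ?Eb.
    have : g (inl (q, 0%N)) = false.
      by rewrite gf ?f0 // !inE; apply/orP; right; apply/orP; right; exact: map_f.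
    by rewrite gE /= eqxx.
  by rewrite gE /= => /andP[/eqP aa' _] /andP[/eqP ba' _]; apply: ba; rewrite ba'.
exists w0, (fun=> false); apply/funext => -[[q k]|[b k]] /=; first exact: f0.
rewrite andbF; apply/negbTE/negP => fbk.
by apply: nf; exists b, k.
Qed.

Lemma level_ge a n : (n < level (inr (a, n)))%N.
Proof.
rewrite /=; elim: n => [|n IHn]; first by rewrite big_ord_recr /= addnS.
by rewrite big_ord_recr /= -addn1 leq_add.
Qed.

Lemma level_bound a m n : (m <= n)%N -> (bound a m < level (inr (a, n)))%N.
Proof.
move=> mn /=; rewrite (bigD1 (inord m)) //= inordK ?ltnS //.
exact: leq_addr.
Qed.

(** If [C] meets a cell, the first digits in that cell decide everything of
small level, by the bound on the length of guesses.  Otherwise [C] lies in the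
union of the fibers: a nonzero point of [C] has a neighbourhood inside one
fiber, where [level] tends to infinity; and if there is no nonzero point, [C]
is a singleton. *)
Lemma rn_set_fragments (C : set (cube coord)) k : C `<=` rn_set -> C !=set0 ->
  exists p0 (s : seq coord), C p0 /\ forall p q, C p -> C q ->
    (forall c, c \in s -> p c = p0 c) -> (forall c, c \in s -> q c = p0 c) ->
    forall c, (level c < k)%N -> p c = q c.
Proof.
move=> CA [c0 Cc0].
have [[q [y Cqy]]|nC] := pselect (exists q y, C (cell_point q y)).
  exists (cell_point q y), [seq inl (q, n) | n <- iota 0 k.+1].
  split=> //.
  have agree p : C p -> (forall c, c \in [seq inl (q, n) | n <- iota 0 k.+1] ->
      p c = cell_point q y c) ->
    exists2 y', p = cell_point q y' & forall n, (n < k)%N -> y' n = y n.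
    move=> /CA Ap pE.
    have p0 : p (inl (q, 0%N)) by rewrite pE ?map_f ?mem_iota //= eqxx.
    case: Ap => [[q' [y' pE']]|[a [z pE']]]; last by rewrite pE' in p0.
    move: p0; rewrite pE' /= andbT => /eqP qq'; subst q'.
    exists y' => // n nk; have /pE :
        (inl (q, n.+1) : coord) \in [seq inl (q, i) | i <- iota 0 k.+1].
      by apply/mapP; exists n.+1; rewrite ?mem_iota.
    by rewrite pE' /= eqxx.
  move=> p p' Cp Cp' /agree -/(_ Cp)[y1 -> y1y] /agree -/(_ Cp')[y2 -> y2y].
  move=> [[q' n]|[a n]] /= nk.
    case: n nk => // n /ltnW nk; congr (_ && _); by rewrite y1y ?y2y.
  rewrite /trace; case E: (guess a q) => [s|//]; case: ltnP => // qn.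
  apply: switch_ext => i si.
  have ik : (i < k)%N.
    apply: leq_ltn_trans si _; apply: leq_ltn_trans (guess_bound E) _.
    exact: leq_trans (level_bound a qn) (ltnW nk).
  by rewrite y1y ?y2y.
have CB p : C p -> exists a z, p = fiber_point a z.
  by move=> Cp; case: (CA _ Cp) => // -[q [y pE]]; case: nC; exists q, y; rewrite -pE.
have [[a [n [z [Caz zn]]]]|nz] :=
    pselect (exists a n z, C (fiber_point a z) /\ z n = true).
  exists (fiber_point a z), (inr (a, n) :: [seq inr (a, i) | i <- iota 0 k]).
  split => //.
  have agree p : C p -> (forall c,
        c \in (inr (a, n) :: [seq inr (a, i) | i <- iota 0 k]) ->
        p c = fiber_point a z c) ->
      exists2 z', p = fiber_point a z' & forall i, (i < k)%N -> z' i = z i.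
    move=> /CB[a' [z' pE]] H.
    have := H (inr (a, n)); rewrite pE /= !inE !eqxx zn => /(_ isT) /=.
    move=> /andP[/eqP aa' _]; subst a'; exists z' => // i ik.
    have /H : (inr (a, i) : coord) \in
        inr (a, n) :: [seq inr (a, i) | i <- iota 0 k].
      by rewrite inE; apply/orP; right; apply/mapP; exists i; rewrite ?mem_iota.
    by rewrite pE /= eqxx.
  move=> p p' Cp Cp' /agree -/(_ Cp)[z1 -> z1z] /agree -/(_ Cp')[z2 -> z2z].
  move=> [[q' i]|[b i]] //= ik; case: eqVneq ik => //= -> ik.
  have {}ik := ltn_trans (level_ge a i) ik.
  by rewrite z1z ?z2z.
exists c0, [::]; split=> // p p' /[dup] Cp /CB[a [z pE]] /[dup] Cp' /CB[a' [z' pE']].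
move=> _ _ c _; rewrite pE pE'; case: c => // -[b n] /=.
have -> : z n = false.
  by apply/negP => zn; apply: nz; exists a, n, z; rewrite -pE.
have -> : z' n = false.
  by apply/negP => zn; apply: nz; exists a', n, z'; rewrite -pE'.
by rewrite !andbF.
Qed.

Lemma rn_set_radon_nikodym (R : realType) (w0 : W) : radon_nikodym R rn_set.
Proof.
split; first split.
- apply: compact_set_type; apply: (subclosed_compact (closed_rn_set w0)) (@cube_compact _) _.
  exact: subsetT.
- exact/hausdorff_set_type/cube_hausdorff.
exists (fun p q => wdist R level (set_val p) (set_val q)); split.
- have [? eq0 ? ?] := wdist_metric R level; split => //.
    by move=> x y; rewrite eq0; split => [/val_inj|->].
- exact: wdist_lsc.
- by apply: wdist_fragments; exact: rn_set_fragments.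
Qed.

(** The points [111...] of the fibers form a discrete family, each separated
from the others by its own first digit. *)
Lemma rn_set_weight_ge (B : set (set rn_set)) : basis B -> [set: W] #<= B.
Proof.
move=> [oB bB]; pose one (a : W) : rn_set :=
  exist _ (fiber_point a (fun=> true)) (mem_set (or_intror (ex_intro _ a
    (ex_intro _ (fun=> true) erefl)))).
have /choice[b bP] : forall a, exists V, [/\ B V, V (one a) &
    forall x, V x -> set_val x (inr (a, 0%N)) = true].
  move=> a; have [|V [BV Va] VP] := bB (one a)
      [set x | set_val x (inr (a, 0%N)) = set_val (one a) (inr (a, 0%N))].
    exact: nbhs_coord.
  exists V; split => // x /VP -> ; rewrite /one set_valE /=.
  by rewrite eqxx.
have binj : injective b.
  move=> a a' E; have [_ Va _] := bP a; have [_ _ /(_ (one a))] := bP a'.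
  by rewrite -E /one set_valE /= => /(_ Va)/andP[/eqP].
rewrite (card_le_trans (B := b @` setT)) //; last first.
  by apply: subset_card_le => _ [a _ <-]; have [] := bP a.
have : (b @` setT #= [set: W])%card by apply: inj_card_eq => x y _ _; exact: binj.
by rewrite card_eq_le => /andP[].
Qed.

End Points.

(** * The weight *)

Lemma card_le_inj (S T : Type) (f : S -> T) : injective f ->
  [set: S] #<= [set: T].
Proof.
move=> finj; apply: (card_le_trans (B := f @` setT)); last exact: subset_card_le.
have : (f @` setT #= [set: S])%card by apply: inj_card_eq => x y _ _; exact: finj.
by rewrite card_eq_le => /andP[].
Qed.

Section Weight.
Variables (disp : Order.disp_t) (W : orderType disp) (oW : is_omega1 W).

(** A finite sequence lies below some ordinal, and is then coded by that ordinal
together with the list of ranks of its entries in a countable segment. *)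
Lemma omega1_seq : exists f : seq W -> W, injective f.
Proof.
have [p pinj] := omega1_prod_nat oW.
have /choice[r rinj] : forall a : W, exists r : W -> nat,
    {in [set b | (b < a)%O] &, injective r}.
  by move=> a; apply/countable_injP; exact: omega1_segment_countable.
have /choice[top topP] : forall s : seq W, exists a, forall b, b \in s -> (b < a)%O.
  move=> s; have [|a aP] := @omega1_countable_bounded _ W [set` s] oW.
    exact: finite_set_countable.
  by exists a.
exists (fun s => p (top s, choice.pickle (map (r (top s)) s))) => s t /pinj[ts].
move=> /(pcan_inj choice.pickleK); rewrite -ts => E.
have sz : size s = size t by rewrite -(size_map (r (top s)) s) E size_map.
apply: (@eq_from_nth _ (top s)) => // i si; apply: (rinj (top s)).
- by rewrite inE; apply: topP; exact: mem_nth.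
- by rewrite inE ts; apply: topP; rewrite mem_nth // -sz.
- by rewrite -(nth_map (top s) 0%N) // E (nth_map (top s)) // -sz.
Qed.

Lemma coord_card : exists f : seq (coord W * bool) -> W, injective f.
Proof.
have [p pinj] := omega1_prod_nat oW; have [f finj] := omega1_seq.
pose j (c : coord W * bool) : W := match c.1 with
  | inl (q, k) => p (q.1, choice.pickle (q.2, k, c.2, true))
  | inr (a, k) => p (a, choice.pickle ([::] : seq bool, k, c.2, false)) end.
exists (f \o map j); apply: inj_comp finj _; apply: inj_map.
move=> [[[[a s] k]|[a k]] b] [[[[a' s'] k']|[a' k']] b'] /pinj /= [->]
  /(pcan_inj choice.pickleK) E; by case: E => // *; subst.
Qed.

Lemma set_cube_basis_le (A : set (cube (coord W))) :
  exists2 B : set (set A), basis B & B #<= [set: W].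
Proof.
pose V (s : seq (coord W * bool)) : set A := set_val @^-1` (cylinder s).
exists (range V); last first.
  apply: (card_le_trans (card_image_le _ _)).
  by have [f finj] := coord_card; exact: card_le_inj finj.
split=> [_ [s _ <-]|x D [_ [[G oG <-] Gx GD]]].
  by exists (cylinder s) => //; exact: (@open_cylinder (coord W) bool).
have [s [sx sG]] := @nbhs_cylinder (coord W) bool _ _ (open_nbhs_nbhs (conj oG Gx)).
exists (V s); first by split => //; exists s.
by move=> y Vy; apply: GD; exact: sG.
Qed.

Lemma rn_set_weight guess : has_weight (rn_set (W := W) guess) [set: W].
Proof.
split=> [|B]; last exact: rn_set_weight_ge.
have [B bB BW] := set_cube_basis_le (rn_set (W := W) guess).
by exists B => //; rewrite card_eq_le BW rn_set_weight_ge.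
Qed.

End Weight.

(** * Binary expansions *)

Section Binary.
Variable R : realType.

Let h n : R := 2^-1 ^+ n.

Let hS n : h n = h n.+1 + h n.+1.
Proof. rewrite /h exprS; lra. Qed.

Let h_ge0 n : 0 <= h n.
Proof. by rewrite /h exprn_ge0. Qed.

Definition partial (z : nat -> bool) n : R := \sum_(k < n) (z k)%:R * h k.+1.

Definition binary (z : nat -> bool) : R := sup (range (partial z)).

(** For [b = 0] and [b = 1], these are the two ends of the dyadic interval coded
by [t]. *)
Definition pad (t : seq bool) (b : bool) (n : nat) : bool :=
  if (n < size t)%N then nth false t n else b.

Let partialS z n : partial z n.+1 = partial z n + (z n)%:R * h n.+1.
Proof. by rewrite /partial big_ord_recr. Qed.

Let partial_up z n m : partial z n <= partial z (n + m).
Proof.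
elim: m => [|m IHm]; first by rewrite addn0.
by rewrite addnS partialS (le_trans IHm) // lerDl mulr_ge0.
Qed.

Let partial_down z n m : partial z (n + m) + h (n + m) <= partial z n + h n.
Proof.
elim: m => [|m IHm]; first by rewrite addn0.
apply: le_trans IHm; rewrite addnS partialS -addrA lerD2l (hS (n + m)) lerD2r.
by case: (z _); rewrite ?mul1r ?mul0r.
Qed.

Lemma partial_le z n m : partial z m <= partial z n + h n.
Proof.
have [nm|/ltnW mn] := leqP n m.
  rewrite -(subnKC nm); apply: le_trans (partial_down z n (m - n)).
  by rewrite lerDl.
rewrite -(subnKC mn); apply: le_trans (partial_up z m (n - m)) _.
by rewrite lerDl.
Qed.

Let sup_partial z : has_sup (range (partial z)).
Proof.
split; first by exists (partial z 0), 0%N.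
by exists (partial z 0 + h 0) => _ [m _ <-]; exact: partial_le.
Qed.

Lemma binary_ge z n : partial z n <= binary z.
Proof. by apply: ub_le_sup; [exact: (sup_partial z).2|exists n]. Qed.

Lemma binary_le z n : binary z <= partial z n + h n.
Proof.
apply: ge_sup; first exact: (sup_partial z).1.
by move=> _ [m _ <-]; exact: partial_le.
Qed.

Lemma binary_close z z' n : (forall k, (k < n)%N -> z k = z' k) ->
  `|binary z - binary z'| <= h n.
Proof.
move=> zz'; have E : partial z n = partial z' n.
  by apply: eq_bigr => k _; rewrite zz'.
have := binary_ge z n; have := binary_le z n.
have := binary_ge z' n; have := binary_le z' n.
rewrite E ler_norml => *; apply/andP; split; lra.
Qed.

(** Both ends equal the middle of the interval of [t]: the partial sums of the
first, corrected by the remaining [2 ^ - n], are those of the second. *)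
Lemma binary_carry t :
  binary (pad (rcons t false) true) = binary (pad (rcons t true) false).
Proof.
set z := pad _ true; set z' := pad _ false; set m := size t.
have lt_eq k : (k < m)%N -> z k = z' k.
  by move=> km; rewrite /z /z' /pad !size_rcons ltnS (ltnW km) !nth_rcons km.
have zm : z m = false /\ z' m = true.
  by rewrite /z /z' /pad !size_rcons ltnS leqnn !nth_rcons ltnn eqxx.
have z_gt k : (m < k)%N -> z k = true /\ z' k = false.
  by move=> mk; rewrite /z /z' /pad !size_rcons !ltnS leqNgt mk.
have E n : partial z (m.+1 + n) + h (m.+1 + n) = partial z' (m.+1 + n).
  elim: n => [|n IHn].
    rewrite addn0 !partialS zm.1 zm.2 mul0r mul1r addr0; congr (_ + _).
    by apply: eq_bigr => k _; rewrite lt_eq.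
  have [zt zf] := z_gt (m.+1 + n)%N (leq_addr _ _).
  rewrite addnS (partialS z) (partialS z') zt zf mul1r mul0r addr0 -IHn.
  by rewrite -addrA -hS.
apply/eqP; rewrite -subr_eq0 -normr_eq0; apply/eqP/le_anti; rewrite normr_ge0 andbT.
rewrite leNgt; apply/negP => /(@small_pow R)[n ne].
have : `|binary z - binary z'| <= h n.
  have := binary_ge z (m.+1 + n.+1); have := binary_le z (m.+1 + n.+1).
  have := binary_ge z' (m.+1 + n.+1); have := binary_le z' (m.+1 + n.+1).
  rewrite -E; have : h (m.+1 + n.+1) + h (m.+1 + n.+1) <= h n.
    rewrite addnS -hS /h ler_wiXn2l ?invr_ge0 ?invf_le1 ?ler1n //.
    exact: leq_addl.
  rewrite ler_norml => *; apply/andP; split; lra.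
by rewrite leNgt ne.
Qed.

Lemma binary_pad_neq : binary (pad [::] false) <> binary (pad [::] true).
Proof.
have z0 n : partial (pad [::] false) n = 0.
  by apply: big1 => k _; rewrite /pad mul0r.
have := binary_le (pad [::] false) 2; have := binary_ge (pad [::] true) 1.
rewrite z0 /partial big_ord_recr big_ord0 /= add0r /pad /= mul1r add0r.
rewrite (hS 1) => H1 H2 E; rewrite E in H2.
have : 0 < h 2 by rewrite /h exprn_gt0.
by lra.
Qed.

Lemma pad_rcons t b : pad (rcons t b) b = pad t b.
Proof.
apply/funext => n; rewrite /pad size_rcons ltnS nth_rcons leq_eqVlt.
by case: ltngtP.
Qed.

End Binary.

(** * The glued image *)

Lemma prod_continuous (S : topologicalType) (I : eqType)
    (T : topologicalType) (f : S -> prod_topology (fun _ : I => T)) :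
  (forall i, continuous (fun x => f x i)) -> continuous f.
Proof.
move=> cf x; apply/cvg_sup => i B [_ [[C oC <-] Cf CB]].
apply: (filterS CB); apply: (cf i x); exact: open_nbhs_nbhs.
Qed.

Section Image.
Variables (R : realType) (W : choiceType).
Variables (guess : W -> cell W -> option (seq bool)).
Hypothesis guess_ad : forall a b, a <> b ->
  exists L : seq (cell W), forall q, guess a q -> guess b q -> q \in L.
Hypothesis guess_hits : forall ext : cell W -> seq bool, exists a, forall l,
  exists2 n, (l <= n)%N & forall t, size t = n -> forall L : seq (cell W),
  exists q, [/\ q \notin L, q.2 = t & guess a q = Some (ext q)].

Let K := rn_set guess.

Definition glue (p : cube (coord W)) :
    prod_topology (fun _ : (cell W * nat + W)%type => R : topologicalType) :=
  fun c => match c with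
  | inl x => (p (inl x))%:R
  | inr a => binary R (fun n => p (inr (a, n)))
  end.

Lemma glue_continuous : continuous glue.
Proof.
apply: prod_continuous => -[x|a] p; apply/cvgrPdist_lt => e e0.
  apply: filterS (nbhs_cube p [:: inl x]) => g /(_ _ (mem_head _ _)) /= ->.
  by rewrite subrr normr0.
have [n ne] := small_pow e0.
apply: filterS (nbhs_cube p [seq inr (a, k) | k <- iota 0 n]) => g gp.
apply: le_lt_trans ne; apply: binary_close => k kn; rewrite gp //.
by apply/mapP; exists k; rewrite ?mem_iota.
Qed.

Definition glued := glue @` K.

Definition glue_map (x : K) : glued :=
  exist _ (glue (set_val x)) (mem_set (imageP glue (set_valP x))).

Lemma glue_map_continuous : continuous glue_map.
Proof.
move=> x B [_ [[C oC <-] Cx CB]].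
have : nbhs x (set_val @^-1` (glue @^-1` C)); last first.
  by move=> H; apply: filterS H => y Cy; exact: CB.
apply: initial_continuous; apply: glue_continuous; exact: open_nbhs_nbhs.
Qed.

Lemma glue_map_surj : range glue_map = [set: glued].
Proof.
apply/seteqP; split => // -[y yK] _; have [p Kp py] := set_mem yK.
by exists (exist _ p (mem_set Kp)) => //; apply: val_inj.
Qed.

Lemma glued_compact_hausdorff (w0 : W) : compact_hausdorff glued.
Proof.
split.
  apply/compact_set_type/continuous_compact.
    exact/continuous_subspaceT/glue_continuous.
  apply: (subclosed_compact (closed_rn_set guess_ad w0)) (@cube_compact _) _.
  exact: subsetT.
by apply/hausdorff_set_type/hausdorff_product => _; exact: Rhausdorff.
Qed.

Let cellK q y : K :=
  exist _ (cell_point guess q y) (mem_set (or_introl (ex_intro _ q (ex_intro _ y erefl)))).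

Let fiberK a z : K :=
  exist _ (fiber_point a z) (mem_set (or_intror (ex_intro _ a (ex_intro _ z erefl)))).

(** This is convergence of the cells selected by [a] over [t] to the end
[pad t b] of a piece of its fiber: a given coordinate has the limit value in all
but finitely many of these cells.  For the coordinates of another fiber, the
exceptions are the cells selected by both. *)
Lemma fiber_limit a t b (ls : seq (coord W)) : exists L : seq (cell W),
  forall q, q \notin L -> q.2 = t -> forall s, guess a q = Some s ->
  forall c, c \in ls -> cell_point guess q (pad s b) c = fiber_point a (pad t b) c.
Proof.
elim: ls => [|c ls [L IHL]]; first by exists [::].
suff [M MP] : exists M : seq (cell W), forall q, q \notin M -> q.2 = t ->
    forall s, guess a q = Some s ->
    cell_point guess q (pad s b) c = fiber_point a (pad t b) c.
  exists (M ++ L) => q; rewrite mem_cat negb_or => /andP[qM qL] qt s gq c'.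
  by rewrite inE => /orP[/eqP ->|c'ls]; [exact: MP|exact: IHL].
case: c => [[q' k]|[b' n]].
  by exists [:: q'] => q; rewrite inE eq_sym /= => /negbTE ->.
have [->|/eqP ba] := eqVneq b' a.
  exists [::] => q _ qt s gq; rewrite /= /trace gq eqxx qt /pad /=.
  case: ifP => // _; rewrite /switch ltnn.
  suff -> : mkseq (pad s b) (size s) == s by [].
  apply/eqP/(@eq_from_nth _ false); rewrite size_mkseq // => i si.
  by rewrite nth_mkseq // /pad si.
have [L' LP] := guess_ad ba; exists L' => q qL _ s gq.
rewrite /= (introF eqP ba) /= /trace; case gb: (guess b' q) => //.
by move: qL; rewrite LP ?gb ?gq.
Qed.

Lemma glued_nbhs (x : K) (V : set glued) : nbhs (glue_map x) V ->
  exists ls : seq (coord W), forall y : K,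
    (forall c, c \in ls -> set_val y c = set_val x c) -> V (glue_map y).
Proof.
move=> [_ [[C oC <-] Cx CV]].
have /nbhs_cubeE[ls lsC] : nbhs (set_val x) (glue @^-1` C).
  by apply: glue_continuous; exact: open_nbhs_nbhs.
by exists ls => y /lsC Cy; apply: CV; exact: Cy.
Qed.

(** By lower semi-continuity, the diameter of [ext q] in the cells that [a]
guesses correctly bounds the lengths of the pieces of rank [n] of its fiber;
these are chained along the glued ends to the whole interval. *)
Lemma glued_not_radon_nikodym : ~ radon_nikodym R glued.
Proof.
move=> [_ [d [[d_ge0 d_eq0 _ d_triangle] dlsc dfrag]]].
pose e n : R := 2^-1 ^+ n.
have e_gt0 n : 0 < e n by rewrite /e exprn_gt0.
(* The exponent [2 * size q.2] makes the sum over the [2 ^ n] pieces small. *)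
have /choice[ext extP] : forall q : cell W, exists s : seq bool, forall b b',
    d (glue_map (cellK q (pad s b))) (glue_map (cellK q (pad s b'))) <=
    e (size q.2 + size q.2)%N.
  move=> q; have [|U [oU [z [Uy [y _ yE]]] Udiam]] :=
      dfrag _ (e_gt0 (size q.2 + size q.2)%N) (range (glue_map \o cellK q)).
    by exists (glue_map (cellK q xpredT)), xpredT.
  subst z.
  have /glued_nbhs[ls lsU] := open_nbhs_nbhs (conj oU Uy).
  have [m mP] : exists m, forall y', (forall k, (k < m)%N -> y' k = y k) ->
      forall c, c \in ls -> cell_point guess q y' c = cell_point guess q y c.
    elim: ls {lsU} => [|c ls [m IHm]]; first by exists 0%N.
    have [m' mc] := cell_point_ext guess q c.
    exists (maxn m m') => y' y'y c'; rewrite inE => /orP[/eqP ->|c'ls].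
      by apply: mc => k km; apply: y'y; rewrite leq_max km orbT.
    by apply: IHm => // k km; apply: y'y; rewrite leq_max km.
  exists (mkseq y m) => b b'.
  have Ub b0 : U (glue_map (cellK q (pad (mkseq y m) b0))).
    apply: lsU; apply: mP => k km.
    by rewrite /pad size_mkseq km nth_mkseq.
  rewrite -lee_fin; apply: le_trans (ltW Udiam); apply: ereal_sup_ubound.
  by exists (glue_map (cellK q (pad (mkseq y m) b)),
    glue_map (cellK q (pad (mkseq y m) b'))) => //; split; split => //=;
    [exists (pad (mkseq y m) b)|exists (pad (mkseq y m) b')].
have [a aP] := guess_hits ext.
pose P z := glue_map (fiberK a z).
have P_carry t : P (pad (rcons t false) true) = P (pad (rcons t true) false).
  apply: val_inj; apply/funext => -[x|b] //=.
  have [->|/eqP ba] := eqVneq b a; last first.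
    by congr binary; apply/funext => n; rewrite !set_valE /= (introF eqP ba).
  have E z : (fun n : nat => fiber_point a z (inr (a, n))) = z.
    by apply/funext => n /=; rewrite eqxx.
  by rewrite !set_valE /= !E binary_carry.
have small n : (forall t, size t = n -> forall L : seq (cell W),
    exists q, [/\ q \notin L, q.2 = t & guess a q = Some (ext q)]) ->
  forall t, size t = n -> d (P (pad t false)) (P (pad t true)) <= e (n + n)%N.
  move=> hits t tn; rewrite leNgt; apply/negP => lt_d.
  have [|V [[V1 V2] /= [nV1 nV2] V12] VP] :=
      dlsc (P (pad t false), P (pad t true)) (e (n + n)%N).
    by rewrite lte_fin.
  have [ls1 ls1V] := glued_nbhs nV1; have [ls2 ls2V] := glued_nbhs nV2.
  have [L1 L1P] := fiber_limit a t false ls1.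
  have [L2 L2P] := fiber_limit a t true ls2.
  have [q [qL qt gq]] := hits _ tn (L1 ++ L2).
  move: qL; rewrite mem_cat negb_or => /andP[qL1 qL2].
  have /VP : V (glue_map (cellK q (pad (ext q) false)),
                glue_map (cellK q (pad (ext q) true))).
    apply: V12; split => /=.
      by apply: ls1V => c cls; exact: L1P.
    by apply: ls2V => c cls; exact: L2P.
  by rewrite lte_fin ltNge /=; have := extP q false true; rewrite qt tn => ->.
(* Halving the piece [t] through the glued midpoint. *)
have chain n j : (forall t, size t = n -> forall L : seq (cell W),
    exists q, [/\ q \notin L, q.2 = t & guess a q = Some (ext q)]) ->
  forall t, (size t + j)%N = n ->
  d (P (pad t false)) (P (pad t true)) <= 2 ^+ j * e (n + n)%N.
  move=> hits; elim: j => [|j IHj] t tn.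
    by rewrite mul1r; apply: small; rewrite // -tn addn0.
  apply: le_trans (d_triangle _ (P (pad (rcons t false) true)) _) _.
  rewrite exprS -mulrA mulr_natl mulr2n; apply: lerD.
    rewrite -(pad_rcons t false); apply: IHj.
    by rewrite size_rcons addSnnS.
  rewrite P_carry -(pad_rcons t true); apply: IHj.
  by rewrite size_rcons addSnnS.
have P0 : P (pad [::] false) = P (pad [::] true).
  apply/d_eq0/le_anti; rewrite d_ge0 andbT.
  rewrite leNgt; apply/negP => /(@small_pow R)[l lP].
  have [n ln hits] := aP l.
  have := chain n n hits [::] (add0n n).
  rewrite /e exprD mulrA -exprMn divff // expr1n mul1r => dn.
  have nl : (2^-1 : R) ^+ n <= 2^-1 ^+ l.
    by rewrite ler_wiXn2l ?invr_ge0 ?invf_le1 ?ler1n.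
  by have := lt_le_trans lP (le_trans dn nl); rewrite ltxx.
have := congr1 (fun x : glued => set_val x (inr a)) P0.
have E z : (fun n : nat => fiber_point a z (inr (a, n))) = z.
  by apply/funext => n /=; rewrite eqxx.
by rewrite !set_valE /= !E => /binary_pad_neq.
Qed.

End Image.

(** * Generic guesses *)

Definition splits (x y : nat -> bool) (k : nat) : Prop :=
  (forall m, (m < k)%N -> x m = y m) /\ x k <> y k.

Lemma splits_ex x y : x <> y -> exists k, splits x y k.
Proof.
move=> xy; have ex : exists k, x k != y k.
  apply: contrapT => H; apply: xy; apply/funext => k; apply/eqP.
  by apply: contrapT => /negP xyk; apply: H; exists k.
exists (ex_minn ex); case: ex_minnP => k /eqP xyk kmin; split=> // m mk.
by apply/eqP; apply: contraTT mk => /kmin; rewrite -leqNgt.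
Qed.

Lemma splits_uniq x y k k' : splits x y k -> splits x y k' -> k = k'.
Proof.
by move=> [H1 H2] [H3 H4]; case: (ltngtP k k') => // [/H3|/H1].
Qed.

Lemma short_seqs (n : nat) : exists T : seq (seq bool),
  forall t, (size t <= n)%N -> t \in T.
Proof.
elim: n => [|n [T TP]].
  by exists [:: [::]] => t; rewrite leqn0 size_eq0 => /eqP ->.
exists ([::] :: [seq true :: t | t <- T] ++ [seq false :: t | t <- T]).
move=> [|b t] //; rewrite ltnS => /TP tT; rewrite inE mem_cat /=.
by case: b; rewrite map_f ?orbT.
Qed.

Section Guess.
Variables (disp : Order.disp_t) (W : orderType disp) (oW : is_omega1 W).
Variables (x : W -> nat -> bool) (x_inj : injective x).
Variables (p : W * nat -> W) (p_inj : injective p).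
Variables (en : W -> nat -> W).
Hypothesis en_onto : forall a b, (b < a)%O -> exists j, en a j = b.

Section Hit.
Variable y : W -> seq bool * nat -> nat.

(** The guess [y] is read as follows: its row [[::]] gives the bounds on lengths,
and its row [true :: t], at column [k], names a cell over [t] together with a
cylinder.  Cells are named through [en a], a sequence that lists all the ordinals
below [a].  The column has to be the first difference of [x q.1] and [x a], which
leaves one column for each cell, and it has to be at least [size q.2], so that
finitely many cells are hit in the first columns. *)
Definition hit (a : W) (q : cell W) (k : nat) (s : seq bool) : Prop :=
  [/\ splits (x q.1) (x a) k, (size q.2 <= k)%N,
      (size s <= y a ([::], size q.2))%N &
      exists2 j, en a j = q.1 & y a (true :: q.2, k) = choice.pickle (j, s)].

Definition guess_of (a : W) (q : cell W) : option (seq bool) :=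
  if pselect (exists s k, hit a q k s) is left e then Some (sval (cid e))
  else None.

Lemma guess_hit a q s : guess_of a q = Some s -> exists k, hit a q k s.
Proof.
by rewrite /guess_of; case: pselect => // e [<-]; exact: svalP (cid e).
Qed.

Lemma hit_guess a q k s : hit a q k s -> guess_of a q = Some s.
Proof.
move=> h; rewrite /guess_of; case: pselect => [e|[]]; last by exists s, k.
case: (cid e) => s' [k' h'] /=; congr Some.
case: h h' => [sp _ _ [j _ yE]] [sp' _ _ [j' _ yE']].
move: yE'; rewrite -(splits_uniq sp sp') yE.
by move=> /(pcan_inj choice.pickleK)[].
Qed.

Lemma guess_of_bound a q s : guess_of a q = Some s ->
  (size s <= y a ([::], size q.2))%N.
Proof. by move=> /guess_hit[k []]. Qed.

Lemma hit_finite a n : exists L : seq (cell W),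
  forall q k s, (k <= n)%N -> hit a q k s -> q \in L.
Proof.
have [T TP] := short_seqs n.
pose f (k : nat) (t : seq bool) : cell W := (en a
  (if choice.unpickle (y a (true :: t, k)) is Some (j, s)
   then let _ : seq bool := s in j else 0%N), t).
exists [seq f k t | k <- iota 0 n.+1, t <- T].
move=> [i t] k s kn [_ tk _ [j jE yE]]; apply/allpairsPdep; exists k, t.
split; [by rewrite mem_iota|by apply: TP; exact: leq_trans tk kn|].
by move: yE jE; rewrite /f /= => ->; rewrite choice.pickleK => ->.
Qed.

(** A cell hit by [a] and by [b] in columns beyond the first difference [n] of
[x a] and [x b] would have a real agreeing with both at [n]. *)
Lemma guess_of_ad a b : a <> b -> exists L : seq (cell W),
  forall q, guess_of a q -> guess_of b q -> q \in L.
Proof.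
move=> ab; have [|n [_ n_ab]] := @splits_ex (x a) (x b).
  by move=> /x_inj.
have [La LaP] := hit_finite a n; have [Lb LbP] := hit_finite b n.
exists (La ++ Lb) => q; rewrite mem_cat.
case Ea: (guess_of a q) => [s|] // _; case Eb: (guess_of b q) => [s'|] // _.
have [k ha] := guess_hit Ea; have [k' hb] := guess_hit Eb.
have [kn|nk] := leqP k n; first by rewrite (LaP _ _ _ kn ha).
have [kn'|nk'] := leqP k' n; first by rewrite (LbP _ _ _ kn' hb) orbT.
case: ha => -[/(_ _ nk) <- _] _ _ _ in n_ab.
by case: hb => -[/(_ _ nk') E _]; case: n_ab.
Qed.

End Hit.

Section Reading.
Variable a : W.

Definition reads (s : cantor_seg a) (c : W) : Prop :=
  exists ca : (c < a)%O, s (exist _ c ca) = true.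

(** The graph of [ext] is coded bit by bit, each bit at its own place in [W].
Since [p] need not map segments to segments, [a] sees some of the bits only. *)
Definition code_bit (i : W) (t s : seq bool) : W := p (i, choice.pickle (t, s)).

(** What makes a guess at rank [n] possible: [x a] is a limit of
reals [x i] whose cylinders at rank [n] are visible in [sg] and have length at
most [N]. *)
Definition tame (sg : cantor_seg a) (n N : nat) : Prop :=
  forall l, exists k j, [/\ (l <= k)%N, splits (x (en a j)) (x a) k &
    forall t, size t = n -> exists s, (size s <= N)%N /\
      reads sg (code_bit (en a j) t s)].

(** The dense open sets for the guess, given by cylinders: it infinitely often
predicts a bound [N] witnessing [tame], and whenever it has done so for
[size t], it infinitely often predicts a correct cylinder in a cell over [t].
Implications keep these sets dense for the sequences [sg] to which [tame] does
not apply. *)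
Definition target (m : option (seq bool) * nat)
    (w : seq ((seq bool * nat) * nat)) (sg : cantor_seg a) : Prop :=
  match m with
  | (None, l) => exists n N, [/\ w = [:: (([::], n), N)], (l <= n)%N &
      (exists N', tame sg n N') -> tame sg n N]
  | (Some t, l) => exists N,
      (w = [:: (([::], size t), N)] /\ ~ tame sg (size t) N) \/
      exists k j s, [/\ w = [:: (([::], size t), N);
                               ((true :: t, k), choice.pickle (j, s))],
        (l <= k)%N, splits (x (en a j)) (x a) k, (size s <= N)%N &
        reads sg (code_bit (en a j) t s)]
  end.

Lemma borel_reads c : borel [set sg | reads sg c].
Proof.
have [ca|nca] := boolP (c < a)%O; last first.
  apply: (@borel_ext _ (fun=> False)); first exact: borel_const.
  move=> sg; split=> // -[ca].
  by rewrite ca in nca.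
apply: (@borel_ext _ (fun sg : cantor_seg a => sg (exist _ c ca) = true)).
  apply: borel_open.
  rewrite -[X in open X]/(proj (exist _ c ca) @^-1` [set true]).
  apply: open_comp; last exact: discrete_open.
  by move=> sg _; exact: (@proj_continuous {b : W | (b < a)%O} (fun=> bool)).
move=> sg; split=> [|[ca']]; first by exists ca.
by rewrite (bool_irrelevance ca ca').
Qed.

Opaque borel.

Lemma borel_tame n N : borel [set sg | tame sg n N].
Proof.
apply: borel_forall => l; apply: borel_exists => k; apply: borel_exists => j.
apply: (@borel_ext _ (fun sg => (l <= k)%N /\ splits (x (en a j)) (x a) k /\
    forall t, size t = n -> exists s, (size s <= N)%N /\
      reads sg (code_bit (en a j) t s))); last first.
  by move=> sg; split=> [[? []]|[]].
apply: borel_and; first exact: borel_const.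
apply: borel_and; first exact: borel_const.
apply: borel_forall => t; apply: borel_imp; first exact: borel_const.
apply: borel_exists => s; apply: borel_and; first exact: borel_const.
exact: borel_reads.
Qed.

Lemma borel_target m w : borel [set sg | target m w sg].
Proof.
case: m => [[t|] l] /=.
  apply: borel_exists => N; apply: borel_or.
    apply: borel_and; first exact: borel_const.
    by apply: borel_not; exact: borel_tame.
  apply: borel_exists => k; apply: borel_exists => j; apply: borel_exists => s.
  apply: (@borel_ext _ (fun sg => [/\ w = [:: (([::], size t), N);
        ((true :: t, k), choice.pickle (j, s))], (l <= k)%N,
        splits (x (en a j)) (x a) k & (size s <= N)%N] /\
        reads sg (code_bit (en a j) t s))); last first.
    by move=> sg; split=> [[[]]|[]].
  by apply: borel_and; [exact: borel_const|exact: borel_reads].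
apply: borel_exists => n; apply: borel_exists => N.
apply: (@borel_ext _ (fun sg => (w = [:: (([::], n), N)] /\ (l <= n)%N) /\
  ((exists N', tame sg n N') -> tame sg n N))); last first.
  by move=> sg; split=> [[[]]|[]].
apply: borel_and; first exact: borel_const.
apply: borel_imp; last exact: borel_tame.
by apply: borel_exists => N'; exact: borel_tame.
Qed.

Transparent borel.

Lemma fresh_column (w : seq ((seq bool * nat) * nat)) r l :
  exists2 l', (l <= l')%N & forall k, (l' <= k)%N -> forall c, c \in w -> c.1 != (r, k).
Proof.
elim: w => [|[[r' k'] v] w [l' ll' l'P]]; first by exists l.
exists (maxn l' k'.+1); first by rewrite leq_max ll'.
move=> k; rewrite geq_max => /andP[l'k k'k] c; rewrite inE => /orP[/eqP ->|] /=.
  by rewrite xpair_eqE negb_and (ltn_eqF k'k) orbT.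
exact: l'P.
Qed.

Lemma cylinder_update (w : seq ((seq bool * nat) * nat)) z c v :
  (cylinder w : set (seq bool * nat -> nat)) z ->
  (forall d, d \in w -> d.1 != c) ->
  (cylinder w : set (seq bool * nat -> nat)) (fun d => if d == c then v else z d).
Proof.
move=> /allP wz wc; apply/allP => d dw.
by rewrite (negbTE (wc d dw)); exact: wz.
Qed.

Lemma target_dense m sg w0 (z0 : seq bool * nat -> nat) : cylinder w0 z0 ->
  exists w (z : seq bool * nat -> nat),
    [/\ target m w sg, cylinder w0 z & cylinder w z].
Proof.
move=> wz0; case: m => [[t|] l] /=; last first.
  have [n ln fresh] := fresh_column w0 [::] l.
  have [N NP] : exists N, (exists N', tame sg n N') -> tame sg n N.
    have [[N HN]|H] := pselect (exists N', tame sg n N'); first by exists N.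
    by exists 0%N.
  exists [:: (([::], n), N)], (fun d => if d == ([::], n) then N else z0 d).
  split; first by exists n, N.
    by apply: cylinder_update => //; exact: fresh.
  by rewrite /cylinder /= !eqxx.
have [T|nT] := pselect (tame sg (size t) (z0 ([::], size t))); last first.
  exists [:: (([::], size t), z0 ([::], size t))], z0; split => //.
    by exists (z0 ([::], size t)); left.
  by rewrite /cylinder /= eqxx.
have [l' ll' fresh] := fresh_column w0 (true :: t) l.
have [k [j [l'k sp /(_ t erefl)[s [sN rs]]]]] := T l'.
exists [:: (([::], size t), z0 ([::], size t));
           ((true :: t, k), choice.pickle (j, s))].
exists (fun d => if d == (true :: t, k) then choice.pickle (j, s) else z0 d).
split.
- exists (z0 ([::], size t)); right; exists k, j, s; split => //.
  exact: leq_trans ll' l'k.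
- by apply: cylinder_update => //; exact: fresh.
- by rewrite /cylinder /= !eqxx.
Qed.

End Reading.

(** If [a] is not tame at [n], fix [N] bounding its own cylinders at rank [n] and
an initial segment [u] of [x a] beyond which there is no suitable [i].  For
given [(n, N, u)], an [i] of this kind is suitable for every larger [a] of this
kind that lies above the codes of [i]; so there are countably many of this
kind. *)
Lemma tame_often (ext : cell W -> seq bool) (g : W -> bool) (S : set W) :
  (forall i t, g (code_bit i t (ext (i, t))) = true) -> ~ countable S ->
  exists2 a, S a & forall n, exists N, tame (restrict_seg g a) n N.
Proof.
move=> gP uncS; apply: contrapT => H; apply: uncS.
pose B (v : nat * nat * seq bool) : set W := let: (n, N, u) := v in
  [set a | [/\ forall t, size t = n -> (size (ext (a, t)) <= N)%N,
     mkseq (x a) (size u) = u &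
     forall k j, (size u <= k)%N -> splits (x (en a j)) (x a) k ->
       ~ forall t, size t = n -> exists s, (size s <= N)%N /\
           reads (restrict_seg g a) (code_bit (en a j) t s)]].
have SB : S `<=` \bigcup_v B v.
  move=> a Sa.
  have /existsNP[n /forallNP nT] : ~ forall n, exists N, tame (restrict_seg g a) n N.
    by move=> aT; apply: H; exists a.
  have [N NP] : exists N, forall t, size t = n -> (size (ext (a, t)) <= N)%N.
    have [T TP] := short_seqs n.
    exists (\max_(t <- T) size (ext (a, t))) => t tn.
    by apply: leq_bigmax_seq => //; apply: TP; rewrite tn.
  have /existsNP[l lP] := nT N.
  exists (n, N, mkseq (x a) l) => //; split => //; rewrite size_mkseq //.
  by move=> k j lk sp K; apply: lP; exists k, j.
apply: sub_countable (subset_card_le SB) _; apply: bigcup_countable => //.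
move=> [[n N] u] _; apply: contrapT => uncB.
have [i Bi] : B (n, N, u) !=set0.
  by apply/set0P/eqP => E; apply: uncB; rewrite E.
have [b bP] : exists b, forall c, (range (fun m => p (i, m)) `|` [set i]) c -> (c < b)%O.
  apply: omega1_countable_bounded => //; apply: countable_setU => //.
  exact: sub_countable (card_image_le _ _) (countableP _).
have [a Ba ba] : exists2 a, B (n, N, u) a & (b <= a)%O.
  apply: contrapT => nab; apply: uncB.
  apply: sub_countable (omega1_segment_countable oW b); apply: subset_card_le.
  by move=> a Ba /=; rewrite ltNge; apply/negP => ba; apply: nab; exists a.
have ia : (i < a)%O by apply: lt_le_trans ba; apply: bP; right.
have [j jE] := en_onto ia.
have [|k sp] := @splits_ex (x i) (x a).
  by move=> /x_inj E; rewrite E ltxx in ia.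
case: Bi => iN iu _; case: Ba => _ au /(_ k j).
rewrite jE; apply => //.
  rewrite leqNgt; apply/negP => ku; case: sp => _; apply.
  by rewrite -(nth_mkseq false (x i) ku) -(nth_mkseq false (x a) ku) iu au.
move=> t tn; exists (ext (i, t)); split; first exact: iN.
have pa : (code_bit i t (ext (i, t)) < a)%O.
  by apply: lt_le_trans ba; apply: bP; left; exists (choice.pickle (t, ext (i, t))).
by exists pa; rewrite /restrict_seg /= gP.
Qed.

(** The cells of a finite list [L] are hit in finitely many columns, and the
guess is correct in columns beyond these. *)
Lemma guess_of_hits (y : W -> seq bool * nat -> nat) :
  (forall g : W -> bool, stationary [set a | forall m, exists w,
      @target a m w (restrict_seg g a) /\ cylinder w (y a)]) ->
  forall ext : cell W -> seq bool, exists a, forall l,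
  exists2 n, (l <= n)%N & forall t, size t = n -> forall L : seq (cell W),
  exists q, [/\ q \notin L, q.2 = t & guess_of y a q = Some (ext q)].
Proof.
move=> yP ext.
pose g (c : W) : bool := `[< exists i t, c = code_bit i t (ext (i, t)) >].
have gP i t : g (code_bit i t (ext (i, t))) = true.
  by apply/asboolP; exists i, t.
have g_ext i t s : g (code_bit i t s) = true -> s = ext (i, t).
  by move=> /asboolP[i' [t' /p_inj[-> /(pcan_inj choice.pickleK)[-> ->]]]].
have [a Sa aT] := tame_often gP (stationary_uncountable oW (yP g)).
exists a => l; have [w [[n [N [-> ln nT]]]]] := Sa (None, l).
rewrite /cylinder /= andbT => /eqP yN; have {}nT := nT (aT n).
exists n => // t tn L.
have [l' l'P] : exists l', forall q, q \in L -> forall k,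
    splits (x q.1) (x a) k -> (k < l')%N.
  elim: L => [|q L [l' l'P]]; first by exists 0%N.
  have [[k sp]|nsp] := pselect (exists k, splits (x q.1) (x a) k); last first.
    exists l' => q'; rewrite inE => /orP[/eqP -> k sp|]; last exact: l'P.
    by case: nsp; exists k.
  exists (maxn l' k.+1) => q'; rewrite inE => /orP[/eqP -> k' sp'|q'L k' sp'].
    by rewrite (splits_uniq sp' sp) leq_max ltnSn orbT.
  by rewrite leq_max (l'P _ q'L _ sp').
have [w' [[N' H] w'y]] := Sa (Some t, maxn l' n).
case: H => [[w'E nT']|[k [j [s [w'E lk sp sN rs]]]]].
  by case: nT'; move: w'y; rewrite w'E /cylinder /= andbT tn yN => /eqP <-.
move: w'y; rewrite w'E /cylinder /= andbT => /andP[/eqP yN' /eqP yk].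
move: lk; rewrite geq_max => /andP[l'k nk].
exists (en a j, t); split => //.
  by apply/negP => /l'P/(_ k sp); rewrite ltnNge l'k.
rewrite (@hit_guess y a (en a j, t) k s).
  by congr Some; case: rs => ca /= ga; exact: g_ext ga.
by split => //=; [rewrite tn|rewrite yN'|exists j].
Qed.

End Guess.

(** * A continuous image outside the class *)

Theorem theorem3p2 (R : realType)
    (disp : Order.disp_t) (W : orderType disp) (omega1W : is_omega1 W)
    (U : nat -> set spaceX) (baseU : basis (range U)) :
  diamond_nonM W U ->
  exists (K K' : topologicalType) (f : K -> K'),
    [/\ radon_nikodym R K,
        has_weight K [set: W],
        continuous f,
        range f = [set: K'] &
        compact_hausdorff K' /\ ~ radon_nikodym R K'].
Proof.
move=> dia.
have [x x_inj] := omega1_embeds omega1W cantor_uncountable.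
have [p p_inj] := omega1_prod_nat omega1W.
have [w0] : exists w0 : W, True.
  by have [b _] := omega1_countable_bounded omega1W (countable0 W); exists b.
move=> _.
have /choice[en en_onto] : forall a : W, exists e : nat -> W,
    forall b, (b < a)%O -> exists j, e j = b.
  move=> a; have /pfcard_geP[a0|[e]] := omega1_segment_countable omega1W a.
    by exists (fun=> w0) => b ba; have : set0 b by rewrite -a0.
  by exists e => b ba; have [j _ jb] := @surj _ _ _ _ e b ba; exists j.
have [y yP] := diamond_dense baseU dia (@borel_target _ _ x p en)
  (@target_dense _ _ x p en).
pose guess := guess_of x en y; pose bound a n := y a ([::], n).
have guess_bound a q s : guess a q = Some s -> (size s <= bound a (size q.2))%N.
  exact: guess_of_bound.
have guess_ad := guess_of_ad x_inj en y.
have guess_hits := guess_of_hits omega1W x_inj p_inj en_onto yP.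
exists (rn_set guess), (@glued R W guess), (@glue_map R W guess); split.
- exact: (rn_set_radon_nikodym guess_bound guess_ad).
- exact: rn_set_weight.
- exact: glue_map_continuous.
- exact: glue_map_surj.
- split; first exact: glued_compact_hausdorff.
  exact: glued_not_radon_nikodym.
Qed.
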